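(* Let $\mathcal{M}$ be a 3-dimensional Riemannian manifold and let $\gamma=\gamma(s): I\subset\mathbb{R}\to\mathcal{M}$ be a simple smooth regular curve parameterized by arc-length, with Frenet frame $\{T,N,B\}$ and curvature scalars $k_1,k_2$. If $\mathcal{M}$ is a space form ($\mathbb{R}^3$, $\mathbb{S}^3$ or $\mathbb{H}^3$) and $\gamma$ is a constant curvature curve (i.e. $k_1$ and $k_2$ are constants), then the geodesic flow on the tube about $\gamma$, i.e. on the surface parameterized by $$\beta(\cdot,\cdot\,;\rho_0): I\times\mathbb{S}^1\to\mathcal{M},\qquad \beta(s,\psi;\rho_0)=\exp_{\gamma(s)}\big(\rho_0\cos\psi\, N(s)+\rho_0\sin\psi\, B(s)\big),$$ with the metric induced from $\mathcal{M}$, is integrable in the sense of Liouville.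
   Context: Frenet frame: for a curve $\gamma$ parameterized by arc-length $s$ in a 3-dimensional Riemannian manifold $\mathcal{M}$, put $T=\dot\gamma$ and let $\{T,N,B\}$ be an orthonormal frame of $T_{\gamma(s)}\mathcal{M}$, smooth in $s$, satisfying the Frenet–Serret equations $$\frac{D T}{ds}=k_1N,\qquad \frac{D N}{ds}=-k_1T+k_2B,\qquad \frac{D B}{ds}=-k_2N,$$ where $D/ds$ is the covariant derivative along $\gamma$. The functions $k_1(s),k_2(s)$ are called the curvature scalars, and $\gamma$ is a constant curvature curve if $k_1,k_2$ are constants. Space forms: $\mathbb{R}^3$, $\mathbb{S}^3$, $\mathbb{H}^3$ carry their standard metrics of constant sectional curvature $0$, $1$, $-1$ respectively. $\exp_p$ is the Riemannian exponential map of $\mathcal{M}$ at $p$. Standing assumption: $\gamma$ and $\rho_0>0$ are restricted so that the tube is a well-defined (regular, non-self-intersecting) surface: the curvature of $\gamma$ is not too high, no conjugate/focal points are reached along the radial geodesics up to distance $\rho_0$, and $\gamma$ does not pass so close to itself that the tube self-intersects. Integrability: the geodesic flow of an $n$-dimensional Riemannian manifold $(S,g)$ is the Hamiltonian flow on $T^*S$ of $\mathcal{H}=\tfrac12 g^{ij}p_ip_j$. It is Liouville integrable if this Hamiltonian system has $n$ first integrals which are functionally independent and in involution (for the tube, $n=2$). *)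

(* Defs.v *)
From HB Require Import structures.
From mathcomp Require Export all_boot all_order all_algebra.
From mathcomp Require Export all_classical all_reals all_analysis.
Export Order.TTheory GRing.Theory Num.Theory.
Export numFieldNormedType.Exports.

Set Implicit Arguments.
Unset Strict Implicit.
Unset Printing Implicit Defensive.

Local Open Scope classical_set_scope.
Local Open Scope ring_scope.

Definition partial (R : realType) (n : nat) (V : normedModType R)
    (i : 'I_n) (f : 'rV[R]_n -> V) (x : 'rV[R]_n) : V :=
  'D_(delta_mx 0 i) f x.

Fixpoint Ck_on (R : realType) (n : nat) (k : nat) (U : set 'rV[R]_n)
    (f : 'rV[R]_n -> R) : Prop :=
  match k with
  | 0%N => forall x, U x -> {for x, continuous f}
  | k'.+1 => forall i : 'I_n,
      (forall x, U x -> derivable f x (delta_mx 0 i))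
      /\ Ck_on k' U (partial i f)
  end.

(* Meant for open U. *)
Definition smooth_on (R : realType) (n : nat) (U : set 'rV[R]_n)
    (f : 'rV[R]_n -> R) : Prop :=
  forall k, Ck_on k U f.

Definition smooth_curve_on (R : realType) (V : normedModType R) (I : set R)
    (c : R -> V) : Prop :=
  forall k s, I s -> derivable (derive1n k c) s 1.

(* The space forms in their standard embedded models: R^3 itself, the unit
   sphere of Euclidean R^4, and the upper sheet of the hyperboloid
   <x, x> = -1 in R^4 with the Lorentzian form -x0 y0 + x1 y1 + x2 y2 + x3 y3.
   The Riemannian metric is the restriction of [form] to the tangent spaces. *)
Inductive space_form := Euclidean3 | Sphere3 | Hyperbolic3.

Definition ambient (M : space_form) : nat :=
  match M with Euclidean3 => 3 | Sphere3 => 4 | Hyperbolic3 => 4 end.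

Definition curvature (R : realType) (M : space_form) : R :=
  match M with Euclidean3 => 0 | Sphere3 => 1 | Hyperbolic3 => -1 end.

Definition signature (R : realType) (M : space_form) (i : nat) : R :=
  match M, i with Hyperbolic3, 0%N => -1 | _, _ => 1 end.

Definition form (R : realType) (M : space_form) (u v : 'rV[R]_(ambient M)) : R :=
  \sum_(i < ambient M) signature R M i * u 0 i * v 0 i.

Definition points (R : realType) (M : space_form) : set 'rV[R]_(ambient M) :=
  match M return set 'rV[R]_(ambient M) with
  | Euclidean3 => setT
  | Sphere3 => [set x | @form R Sphere3 x x = 1]
  | Hyperbolic3 => [set x | @form R Hyperbolic3 x x = -1 /\ 0 < x 0 0]
  end.

Definition tangent (R : realType) (M : space_form) (p : 'rV[R]_(ambient M)) :
    set 'rV[R]_(ambient M) :=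
  match M with
  | Euclidean3 => setT
  | _ => [set v | form p v = 0]
  end.

(* For p in M one has <p, p> = curvature when the curvature is 1 or -1, so this
   is the form-orthogonal projection of the ambient space onto T_p M (and the
   identity for R^3). *)
Definition tangent_proj (R : realType) (M : space_form)
    (p w : 'rV[R]_(ambient M)) : 'rV[R]_(ambient M) :=
  w - (curvature R M * form w p) *: p.

(* The Levi-Civita connection of the induced metric: tangential part of the
   ambient derivative. *)
Definition covariant_derivative (R : realType) (M : space_form)
    (c V : R -> 'rV[R]_(ambient M)) (t : R) : 'rV[R]_(ambient M) :=
  tangent_proj (c t) (derive1 V t).

Definition geodesic (R : realType) (M : space_form)
    (c : R -> 'rV[R]_(ambient M)) : Prop :=
  forall t, [/\ points (c t), derivable c t 1, derivable (derive1 c) t 1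
    & covariant_derivative c (derive1 c) t = 0].

(* The endpoint c 1 of the geodesic c with c 0 = p and c' 0 = v; the default
   value p is returned only when no such geodesic exists. *)
Definition riem_exp (R : realType) (M : space_form)
    (p v : 'rV[R]_(ambient M)) : 'rV[R]_(ambient M) :=
  xget p [set y | exists c : R -> 'rV[R]_(ambient M),
    [/\ geodesic c, c 0 = p, derive1 c 0 = v & c 1 = y]].

Record frenet_frame (R : realType) (M : space_form) (I : set R)
    (gamma T N B : R -> 'rV[R]_(ambient M)) (k1 k2 : R -> R) : Prop := {
  frenet_smoothT : smooth_curve_on I T;
  frenet_smoothN : smooth_curve_on I N;
  frenet_smoothB : smooth_curve_on I B;
  frenet_velocity : forall s, I s -> T s = derive1 gamma s;
  frenet_tangent : forall s, I s ->
    [/\ tangent (gamma s) (T s), tangent (gamma s) (N s)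
      & tangent (gamma s) (B s)];
  frenet_unit : forall s, I s ->
    [/\ form (T s) (T s) = 1, form (N s) (N s) = 1 & form (B s) (B s) = 1];
  frenet_orthogonal : forall s, I s ->
    [/\ form (T s) (N s) = 0, form (T s) (B s) = 0 & form (N s) (B s) = 0];
  frenet_DT : forall s, I s ->
    covariant_derivative gamma T s = k1 s *: N s;
  frenet_DN : forall s, I s ->
    covariant_derivative gamma N s = - k1 s *: T s + k2 s *: B s;
  frenet_DB : forall s, I s ->
    covariant_derivative gamma B s = - k2 s *: N s
}.

Definition constant_on (R : realType) (I : set R) (k : R -> R) : Prop :=
  forall s t, I s -> I t -> k s = k t.

(* S^1 is R / 2 pi Z: the coordinates on I x S^1 are q = (s, psi), psi being
   taken modulo 2 pi. *)
Definition tube (R : realType) (M : space_form)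
    (gamma N B : R -> 'rV[R]_(ambient M)) (rho : R) (q : 'rV[R]_2) :
    'rV[R]_(ambient M) :=
  let s := q 0 0 in let psi := q 0 1 in
  riem_exp (gamma s) ((rho * cos psi) *: N s + (rho * sin psi) *: B s).

Definition tube_domain (R : realType) (I : set R) : set 'rV[R]_2 :=
  [set q | I (q 0 0)].

Definition tube_period (R : realType) : 'rV[R]_2 := (2 * pi) *: delta_mx 0 1.

Definition immersion_on (R : realType) (n m : nat) (Q : set 'rV[R]_n)
    (X : 'rV[R]_n -> 'rV[R]_m) : Prop :=
  forall q, Q q -> row_free (\matrix_(i < n) partial i X q).

Definition injective_mod (R : realType) (n : nat) (A : Type)
    (Q : set 'rV[R]_n) (per : 'rV[R]_n) (X : 'rV[R]_n -> A) : Prop :=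
  forall q q', Q q -> Q q' -> X q = X q' ->
    exists k : int, q' = q + k%:~R *: per.

(* By the Gauss lemma, the radial direction is orthogonal to the tubes, so
   regularity of all the tubes of radius at most rho0 says that no focal point
   of gamma occurs along the radial geodesics up to distance rho0. *)
Definition well_defined_tube (R : realType) (M : space_form) (I : set R)
    (gamma N B : R -> 'rV[R]_(ambient M)) (rho0 : R) : Prop :=
  (forall rho, 0 < rho <= rho0 ->
     immersion_on (tube_domain I) (tube gamma N B rho))
  /\ injective_mod (tube_domain I) (tube_period R) (tube gamma N B rho0).

Definition induced_metric (R : realType) (M : space_form) (n : nat)
    (X : 'rV[R]_n -> 'rV[R]_(ambient M)) (q : 'rV[R]_n) : 'M[R]_n :=
  \matrix_(i < n, j < n) form (partial i X q) (partial j X q).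

(* Below, z = row_mx q p : 'rV_(n + n) are the canonical coordinates on the
   cotangent bundle. *)
Definition geodesic_hamiltonian (R : realType) (n : nat)
    (g : 'rV[R]_n -> 'M[R]_n) (z : 'rV[R]_(n + n)) : R :=
  let q := lsubmx z in let p := rsubmx z in
  2^-1 * \sum_(i < n) \sum_(j < n) invmx (g q) i j * p 0 i * p 0 j.

Definition dq (R : realType) (n : nat) (i : 'I_n)
    (F : 'rV[R]_(n + n) -> R) : 'rV[R]_(n + n) -> R :=
  partial (lshift n i) F.

Definition dp (R : realType) (n : nat) (i : 'I_n)
    (F : 'rV[R]_(n + n) -> R) : 'rV[R]_(n + n) -> R :=
  partial (rshift n i) F.

Definition poisson (R : realType) (n : nat) (F G : 'rV[R]_(n + n) -> R)
    (z : 'rV[R]_(n + n)) : R :=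
  \sum_(i < n) (dq i F z * dp i G z - dp i F z * dq i G z).

Definition hamiltonian_field (R : realType) (n : nat)
    (H : 'rV[R]_(n + n) -> R) (z : 'rV[R]_(n + n)) : 'rV[R]_(n + n) :=
  row_mx (\row_(i < n) dp i H z) (\row_(i < n) - dq i H z).

Definition hamiltonian_orbit (R : realType) (n : nat) (W : set 'rV[R]_(n + n))
    (H : 'rV[R]_(n + n) -> R) (J : set R) (z : R -> 'rV[R]_(n + n)) : Prop :=
  forall t, J t -> W (z t) /\ is_derive t 1 z (hamiltonian_field H (z t)).

Definition first_integral (R : realType) (n : nat) (W : set 'rV[R]_(n + n))
    (H F : 'rV[R]_(n + n) -> R) : Prop :=
  forall (J : set R) (z : R -> 'rV[R]_(n + n)),
    open J -> is_interval J -> hamiltonian_orbit W H J z ->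
    forall t t', J t -> J t' -> F (z t) = F (z t').

Definition cotangent (R : realType) (n : nat) (Q : set 'rV[R]_n) :
    set 'rV[R]_(n + n) :=
  [set z | Q (lsubmx z)].

Definition independent_at (R : realType) (n : nat)
    (F : 'I_n -> 'rV[R]_(n + n) -> R) (z : 'rV[R]_(n + n)) : Prop :=
  row_free (\matrix_(i < n, j < n + n) partial j (F i) z).

(* The manifold is S = Q / (Z per), with Q open and stable under translation by
   per, and g is a per-periodic metric on Q; functions on T^*S are functions on
   the cotangent bundle of Q invariant under q |-> q + per. Functional
   independence means independence of the differentials on a dense subset of
   T^*S (this cannot hold at every point: dH = 0 on the zero section). *)
Definition geodesic_flow_liouville_integrable (R : realType) (n : nat)
    (Q : set 'rV[R]_n) (per : 'rV[R]_n) (g : 'rV[R]_n -> 'M[R]_n) : Prop :=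
  let W := cotangent Q in
  let H := geodesic_hamiltonian g in
  exists F : 'I_n -> 'rV[R]_(n + n) -> R,
  [/\ forall i, smooth_on W (F i)
      /\ (forall z, W z -> F i (z + row_mx per 0) = F i z),
      forall i, first_integral W H (F i),
      forall i j z, W z -> poisson (F i) (F j) z = 0
    & W `<=` closure (W `&` [set z | independent_at F z])].

(* Main.v *)
(* In the embedded models the geodesic from p with velocity r w (w unit tangent)
   is cs (r t) p + sn (r t) w, where cs, sn are 1, t or cos, sin or cosh, sinh
   according to the curvature.  Writing C = cs rho0, S = sn rho0,
   f = C - S k1 cos psi and n = - sin psi N + cos psi B, the Frenet equations
   give X_s = f T + S k2 n and X_psi = S n for the tube X, so that
     H = ((p_s - k2 p_psi)^2 / f^2 + p_psi^2 / S^2) / 2.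
   When k1 and k2 are constant, s is a cyclic coordinate and p_s is a Clairaut
   integral.  Since H is strictly convex in p_psi, on each line parallel to the
   p_psi axis dH/dp_psi vanishes at most once, and away from these zeros dH and
   dp_s are independent. *)
Require Import Defs.
From mathcomp Require Import ring lra.

Set Implicit Arguments.
Unset Strict Implicit.
Unset Printing Implicit Defensive.

Local Open Scope classical_set_scope.
Local Open Scope ring_scope.

(** * Differential calculus *)

Section Calculus.
Context {R : realType}.

Lemma is_derive_coord (V : normedModType R) m n (f : V -> 'M[R]_(m, n)) x v
    (df : 'M[R]_(m, n)) i j :
  is_derive x v f df -> is_derive x v (fun y => f y i j) (df i j).
Proof.
move=> [dvf <-]; split; first by move: dvf => /derivable_mxP.
by rewrite derive_mx// mxE.
Qed.

Lemma is_derive_mx (V : normedModType R) m n (f : V -> 'M[R]_(m, n)) x v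
    (df : 'M[R]_(m, n)) :
  (forall i j, is_derive x v (fun y => f y i j) (df i j)) -> is_derive x v f df.
Proof.
move=> H; have dvf : derivable f x v by apply/derivable_mxP => i j; have [] := H i j.
split => //; rewrite derive_mx//; apply/matrixP => i j; rewrite mxE.
by have [] := H i j.
Qed.

Lemma is_derive_scale (V : normedModType R) n (k : V -> R) (f : V -> 'rV[R]_n) x v dk df :
  is_derive x v k dk -> is_derive x v f df ->
  is_derive x v (fun y => k y *: f y) (dk *: f x + k x *: df).
Proof.
move=> hk hf; apply: is_derive_mx => i j.
rewrite [X in is_derive _ _ X _](_ : _ = k * (fun y => f y i j)); last first.
  by apply/funext => y; rewrite mxE.
apply: is_derive_eq.
  by apply: is_deriveM; exact: is_derive_coord.
by rewrite !mxE addrC /GRing.scale/= [dk * _]mulrC.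
Qed.

Lemma eq_of_derive0_mx n (f : R -> 'rV[R]_n) x y :
  (forall t, is_derive t (1 : R) f 0) -> f x = f y.
Proof.
move=> h; apply/matrixP => i j.
apply: (is_derive_0_is_cst (f := fun t => f t i j)) => t.
by apply: is_derive_eq; [exact: (is_derive_coord i j (h t))|rewrite mxE].
Qed.

(** A directional derivative sees [f] only on the line through [x], and the two difference quotients
    coincide. The Hamiltonian is later differentiated this way, being a polynomial on the lines that
    matter. *)
Lemma is_derive_line (V W : normedModType R) (f : V -> W) x v df :
  is_derive (0 : R) 1 (fun h => f (h *: v + x)) df -> is_derive x v f df.
Proof.
move=> [d1 d2]; split; first exact: (proj2 (derivable1P f x v)).
rewrite -d2 /derive; set g1 := fun h => h^-1 *: _; set g2 := fun h => h^-1 *: _.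
suff -> : g1 = g2 by [].
by apply/funext => h; rewrite /g1 /g2 /= addr0 scale0r add0r [_%:A]mulr1.
Qed.

(** Mean value theorem on the segment from [t] to [t'], which lies in [J]. Orbits are controlled
    only on their time interval, so the derivative is known only there. *)
Lemma eq_of_derive0_interval (J : set R) (f : R -> R) :
  is_interval J -> (forall t, J t -> is_derive t (1 : R) f 0) ->
  forall t t', J t -> J t' -> f t = f t'.
Proof.
move=> Ji fJ t t'; wlog tt' : t t' / t <= t'.
  move=> H Jt Jt'; case: (leP t t') => [/H|/ltW /H h]; first exact.
  by apply/esym/h.
move=> Jt Jt'.
have sub x : t <= x <= t' -> J x by move=> xI; exact: (Ji t t' Jt Jt' x xI).
have [x xI| |c _] := @MVT_segment _ f (fun=> 0) _ _ tt'.
- by apply: fJ; apply: sub; rewrite !ltW ?(itvP xI).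
- apply: derivable_within_continuous => x xI.
  by have /fJ[] : J x by apply: sub; rewrite !(itvP xI).
- by rewrite mul0r => /eqP; rewrite subr_eq0 => /eqP.
Qed.

Lemma is_derive_chain (V W : normedModType R) (f : V -> W) (z : R -> V) t dz :
  is_derive t (1 : R) z dz -> differentiable f (z t) ->
  is_derive t (1 : R) (f \o z) ('d f (z t) dz).
Proof.
move=> [dvz dzE] df.
have dz' : differentiable z t by exact/derivable1_diffP.
have dfz : differentiable (f \o z) t by exact: differentiable_comp.
split; first exact/derivable1_diffP.
by rewrite deriveE// diff_comp//= -dzE deriveE.
Qed.

Lemma is_derive_comp1 (V W : normedModType R) (g : R -> W) (f : V -> R) x v b :
  differentiable f x -> is_derive (f x) (1 : R) g b ->
  is_derive x v (g \o f) ('D_v f x *: b).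
Proof.
move=> df [dg dgE].
have dg' : differentiable g (f x) by exact/derivable1_diffP.
have dgf : differentiable (g \o f) x by exact: differentiable_comp.
split; first exact: diff_derivable.
rewrite deriveE// diff_comp//=.
by rewrite (diff1E dg')/= derive1E dgE deriveE.
Qed.

Lemma is_derive_proj n (i : 'I_n) (x v : 'rV[R]_n) :
  is_derive x v (fun y : 'rV[R]_n => y 0 i) (v 0 i).
Proof. exact: (is_derive_coord 0 i (is_derive_id x v)). Qed.

Lemma is_derive_comp_proj (W : normedModType R) n (g : R -> W) (i : 'I_n)
    (x v : 'rV[R]_n) b :
  is_derive (x 0 i) (1 : R) g b ->
  is_derive x v (fun y => g (y 0 i)) (v 0 i *: b).
Proof.
move=> hg; have [_ <-] := is_derive_proj i x v.
exact: (is_derive_comp1 v (differentiable_coord x 0 i) hg).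
Qed.

Lemma diff_partial n (f : 'rV[R]_n -> R) x v : differentiable f x ->
  'd f x v = \sum_i v 0 i * partial i f x.
Proof.
move=> df; rewrite {1}(row_sum_delta v) linear_sum; apply: eq_bigr => i _.
by rewrite linearZ/= /partial deriveE.
Qed.

End Calculus.

(* Being closed under partial derivatives, this class consists of smooth
   functions. *)
Section Elementary.
Context {R : realType} {n : nat}.
Implicit Types U : set 'rV[R]_n.

Inductive elementary U : ('rV[R]_n -> R) -> Prop :=
| elementary_cst c : elementary U (fun=> c)
| elementary_coord i : elementary U (fun x => x 0 i)
| elementaryD f g : elementary U f -> elementary U g -> elementary U (fun x => f x + g x)
| elementaryM f g : elementary U f -> elementary U g -> elementary U (fun x => f x * g x)
| elementary_cos f : elementary U f -> elementary U (fun x => cos (f x))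
| elementary_sin f : elementary U f -> elementary U (fun x => sin (f x))
| elementaryV f : elementary U f -> (forall x, U x -> f x != 0) ->
    elementary U (fun x => (f x)^-1).

Lemma elementary_differentiable U f : elementary U f ->
  forall x, U x -> differentiable f x.
Proof.
elim=> {f} [c|i|f g _ IHf _ IHg|f g _ IHf _ IHg|f _ IH|f _ IH|f _ IH f0] x Ux.
- exact: differentiable_cst.
- exact: differentiable_coord.
- exact: (differentiableD (IHf _ Ux) (IHg _ Ux)).
- exact: (differentiableM (IHf _ Ux) (IHg _ Ux)).
- apply: (differentiable_comp (g := cos) (IH _ Ux)).
  exact/derivable1_diffP/derivable_cos.
- apply: (differentiable_comp (g := sin) (IH _ Ux)).
  exact/derivable1_diffP/derivable_sin.
- exact: (differentiableV (IH _ Ux) (f0 _ Ux)).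
Qed.

(** The usual rules of differentiation stay inside the class. Equality is asked on [U] only, because
    the rule for reciprocals needs a nonzero denominator. *)
Lemma elementary_partial U f (i : 'I_n) : elementary U f ->
  exists2 g, elementary U g & forall x, U x -> partial i f x = g x.
Proof.
have dv h x : elementary U h -> U x -> derivable h x (delta_mx 0 i).
  by move=> eh Ux; apply/diff_derivable/elementary_differentiable; eassumption.
elim=> {f} [c|j|f g ef [f' ef' ff'] eg [g' eg' gg']
  |f g ef [f' ef' ff'] eg [g' eg' gg']|f ef [f' ef' ff']|f ef [f' ef' ff']
  |f ef [f' ef' ff'] f0].
- exists (fun=> 0); first exact: elementary_cst.
  by move=> x _; rewrite /partial derive_cst.
- exists (fun=> (j == i)%:R); first exact: elementary_cst.
  move=> x _; have [_ h] := is_derive_proj j x (delta_mx 0 i).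
  by rewrite /partial h mxE eqxx.
- exists (fun x => f' x + g' x); first exact: elementaryD.
  move=> x Ux; rewrite -ff'// -gg'//; apply: deriveD; exact: dv.
- exists (fun x => f x * g' x + g x * f' x).
    by apply: elementaryD; exact: elementaryM.
  move=> x Ux; rewrite -ff'// -gg'//; apply: deriveM; exact: dv.
- exists (fun x => f' x * (-1 * sin (f x))).
    apply: elementaryM => //; apply: elementaryM; first exact: elementary_cst.
    exact: elementary_sin.
  move=> x Ux; rewrite -ff'// mulN1r.
  have df := elementary_differentiable ef Ux.
  by have [] := is_derive_comp1 (delta_mx 0 i) df (is_derive_cos (f x)).
- exists (fun x => f' x * cos (f x)).
    by apply: elementaryM => //; exact: elementary_cos.
  move=> x Ux; rewrite -ff'//.
  have df := elementary_differentiable ef Ux.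
  by have [] := is_derive_comp1 (delta_mx 0 i) df (is_derive_sin (f x)).
- exists (fun x => -1 * ((f x)^-1 * (f x)^-1) * f' x).
    apply: elementaryM => //; apply: elementaryM; first exact: elementary_cst.
    by apply: elementaryM; exact: elementaryV.
  move=> x Ux; rewrite -ff'// /partial deriveV; [|exact: f0|exact: dv].
  by rewrite mulN1r -expr2 exprVn.
Qed.

(** Continuity and partial derivatives at a point of an open set depend on the germ alone; the
    partial derivatives then agree on [U] as well, which feeds the induction. *)
Lemma Ck_on_ext U k f g : open U -> (forall x, U x -> f x = g x) ->
  Ck_on k U f -> Ck_on k U g.
Proof.
move=> oU; elim: k f g => [|k IH] f g fg /=.
  move=> cf x Ux; have fgx : {near x, f =1 g}.
    by apply: filterS (oU _ Ux); exact: fg.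
  suff : g y @[y --> x] --> f x by rewrite (fg _ Ux).
  apply: cvg_trans (cf _ Ux).
  exact: near_eq_cvg fgx.
move=> + i => /(_ i)[df ckf].
have nfg x : U x -> {near x, f =1 g}.
  by move=> Ux; apply: filterS (oU _ Ux); exact: fg.
split => [x Ux|]; first exact: near_eq_derivable (nfg _ Ux) (df _ Ux).
apply: IH ckf => x Ux.
exact: near_eq_derive (nfg _ Ux).
Qed.

Lemma elementary_smooth U f : open U -> elementary U f -> smooth_on U f.
Proof.
move=> oU + k; elim: k f => [|k IH] f ef.
  by move=> x Ux; apply: differentiable_continuous; exact: elementary_differentiable Ux.
move=> i; split=> [x Ux|]; first exact/diff_derivable/(elementary_differentiable ef).
have [g /IH eg gE] := elementary_partial i ef.
by apply: Ck_on_ext eg => // x Ux; rewrite gE.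
Qed.

End Elementary.

(** * Poisson brackets and first integrals *)

Section Hamiltonian.
Context {R : realType} {n : nat}.
Implicit Types (F G H : 'rV[R]_(n + n) -> R) (W : set 'rV[R]_(n + n)).

Lemma poisson_anti F G z : poisson F G z = - poisson G F z.
Proof. by rewrite /poisson -sumrN; apply: eq_bigr => i _; ring. Qed.

Lemma poisson_self F z : poisson F F z = 0.
Proof. by rewrite /poisson big1// => i _; ring. Qed.

(** By the chain rule, the derivative of [F] along an orbit is dF applied to the Hamiltonian field,
    which is the bracket of [F] with [H]. *)
Lemma first_integral_poisson W H F :
  (forall z, W z -> differentiable F z) ->
  (forall z, W z -> poisson F H z = 0) -> first_integral W H F.
Proof.
move=> dF pF J z _ Ji zJ; apply: eq_of_derive0_interval Ji _ => t /zJ[Wz dz].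
apply: is_derive_eq; first exact: (is_derive_chain dz (dF _ Wz)).
rewrite diff_partial; last exact: dF.
rewrite big_split_ord/= -[RHS](pF _ Wz) /poisson -big_split/=; apply: eq_bigr => i _.
by rewrite /hamiltonian_field row_mxEl row_mxEr !mxE /dq /dp; ring.
Qed.

(** On an open set, equal functions have equal Hamiltonian fields, hence the same orbits. This
    carries the result from a closed formula to the geodesic Hamiltonian. *)
Lemma first_integral_ext W H H' F : open W -> (forall z, W z -> H z = H' z) ->
  first_integral W H F -> first_integral W H' F.
Proof.
move=> oW HH' FH J z oJ Ji zJ; apply: FH oJ Ji _ => t /zJ[Wz dz]; split => //.
suff -> : hamiltonian_field H (z t) = hamiltonian_field H' (z t) by [].
have nHH' : {near z t, H =1 H'} by apply: filterS (oW _ Wz); exact: HH'.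
rewrite /hamiltonian_field; congr row_mx; apply/rowP => i; rewrite !mxE.
  exact: near_eq_derive nHH'.
by congr (- _); exact: near_eq_derive nHH'.
Qed.

End Hamiltonian.

(** * Geodesics of the space forms *)

Section Form.
Context {R : realType} {M : space_form}.
Implicit Types u v w p : 'rV[R]_(ambient M).

Lemma formC u v : form u v = form v u.
Proof. by apply: eq_bigr => i _; ring. Qed.

Lemma formDl u v w : form (u + v) w = form u w + form v w.
Proof. by rewrite /form -big_split/=; apply: eq_bigr => i _; rewrite mxE; ring. Qed.

Lemma formZl a u v : form (a *: u) v = a * form u v.
Proof. by rewrite /form big_distrr/=; apply: eq_bigr => i _; rewrite mxE; ring. Qed.

Lemma formDr u v w : form w (u + v) = form w u + form w v.
Proof. by rewrite formC formDl !(formC w). Qed.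

Lemma formZr a u v : form u (a *: v) = a * form u v.
Proof. by rewrite formC formZl (formC v). Qed.

Lemma is_derive_form (u v : R -> 'rV[R]_(ambient M)) t (du dv : 'rV[R]_(ambient M)) :
  is_derive t (1 : R) u du -> is_derive t (1 : R) v dv ->
  is_derive t (1 : R) (fun s => form (u s) (v s)) (form du (v t) + form (u t) dv).
Proof.
move=> hu hv; rewrite (_ : (fun _ => _) =
    \sum_(i < ambient M)
      (signature R M i \*: ((fun s => u s 0 i) * (fun s => v s 0 i)))); last first.
  by apply/funext => s; rewrite fct_sumE; apply: eq_bigr => i _; rewrite -mulrA.
have ui i := is_derive_coord 0 i hu; have vi i := is_derive_coord 0 i hv.
apply: is_derive_eq.
rewrite /form -big_split/=; apply: eq_bigr => i _.
by rewrite /GRing.scale/=; ring.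
Qed.

Lemma tangentP p v : tangent p v <-> (M = Euclidean3 \/ form p v = 0).
Proof.
by case: M p v => p v /=; split=> // h; [left|right|case: h|right|case: h].
Qed.

(** In the flat model tangency says nothing about [form p v], but the curvature factor vanishes; the
    three models can thus be treated together. *)
Lemma tangent_form p v : tangent p v -> curvature R M * form p v = 0.
Proof.
by move=> /tangentP[h|->]; rewrite ?mulr0//; case: M h p v => // _ p v; rewrite mul0r.
Qed.

Lemma tangent_lin p u v a b :
  tangent p u -> tangent p v -> tangent p (a *: u + b *: v).
Proof.
move=> /tangentP[ME|pu] /tangentP[ME'|pv]; apply/tangentP; try by left.
by right; rewrite formDr !formZr pu pv !mulr0 addr0.
Qed.

End Form.

Section GeneralizedTrigonometry.
Context {R : realType} (M : space_form).

(** With K the curvature, [cs] and [sn] solve y'' = - K y with initial data (1, 0) and (0, 1). *)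
Definition cs (t : R) : R := match M with
  | Euclidean3 => 1 | Sphere3 => cos t | Hyperbolic3 => (expR t + expR (- t)) / 2 end.

Definition sn (t : R) : R := match M with
  | Euclidean3 => t | Sphere3 => sin t | Hyperbolic3 => (expR t - expR (- t)) / 2 end.

Lemma cs0 : cs 0 = 1.
Proof. by rewrite /cs; case: M; rewrite ?cos0// oppr0 !expR0; field. Qed.

Lemma sn0 : sn 0 = 0.
Proof. by rewrite /sn; case: M; rewrite ?sin0// oppr0 !expR0 subrr mul0r. Qed.

Lemma is_derive_expRN (t : R) : is_derive t (1 : R) (fun s => expR (- s)) (- expR (- t)).
Proof.
have hN : is_derive t (1 : R) (fun s : R => - s) (-1) by exact: is_deriveNid.
rewrite -mulrN1.
exact: (is_derive1_comp (is_derive_expR (- t)) hN).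
Qed.

Lemma is_derive_cs (t : R) : is_derive t (1 : R) cs (- curvature R M * sn t).
Proof.
rewrite /cs /sn; case: M => /=.
- by rewrite oppr0 mul0r; exact: is_derive_cst.
- by rewrite mulN1r; exact: is_derive_cos.
- have h := is_derive_expRN t.
  rewrite (_ : (fun _ => _) = 2^-1 \*: (expR + (fun s => expR (- s)))); last first.
    by apply/funext => s; rewrite mulrC.
  by apply: is_derive_eq; rewrite opprK mul1r mulrC.
Qed.

Lemma is_derive_sn (t : R) : is_derive t (1 : R) sn (cs t).
Proof.
rewrite /cs /sn; case: M => /=.
- exact: is_derive_id.
- exact: is_derive_sin.
- have h := is_derive_expRN t.
  rewrite (_ : (fun _ => _) = 2^-1 \*: (expR - (fun s => expR (- s)))); last first.
    by apply/funext => s; rewrite mulrC.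
  by apply: is_derive_eq; rewrite opprK mulrC.
Qed.

Lemma cs2sn2 (t : R) : cs t ^+ 2 + curvature R M * sn t ^+ 2 = 1.
Proof.
rewrite /cs /sn; case: M => /=.
- by rewrite mul0r addr0 expr1n.
- by rewrite mul1r cos2Dsin2.
- have /esym h : expR t * expR (- t) = 1 :> R by rewrite -expRD subrr expR0.
  by rewrite [RHS]h; field.
Qed.

Lemma is_derive_mull (r t : R) : is_derive t (1 : R) (fun s => r * s) r.
Proof.
rewrite (_ : (fun _ => _) = r \*: id)//.
by apply: is_derive_eq; rewrite [LHS]mulr1.
Qed.

Lemma is_derive_csM (r t : R) :
  is_derive t (1 : R) (fun s => cs (r * s)) (- curvature R M * r * sn (r * t)).
Proof.
have h := is_derive_mull r t.
apply: is_derive_eq; first exact: (is_derive1_comp (is_derive_cs (r * t)) h).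
ring.
Qed.

Lemma is_derive_snM (r t : R) :
  is_derive t (1 : R) (fun s => sn (r * s)) (r * cs (r * t)).
Proof.
have h := is_derive_mull r t.
apply: is_derive_eq; first exact: (is_derive1_comp (is_derive_sn (r * t)) h).
ring.
Qed.

End GeneralizedTrigonometry.

(* The combination stays on the upper sheet of the hyperboloid: by Cauchy-Schwarz
   in the spatial coordinates, w0^2 < p0^2. *)
Lemma hyperbolic_stay (R : realFieldType) (C S p0 p1 p2 p3 w0 w1 w2 w3 : R) :
  C ^+ 2 + -1 * S ^+ 2 = 1 -> 0 < C -> 0 < p0 ->
  -1 * p0 * p0 + (1 * p1 * p1 + (1 * p2 * p2 + (1 * p3 * p3 + 0))) = -1 ->
  -1 * p0 * w0 + (1 * p1 * w1 + (1 * p2 * w2 + (1 * p3 * w3 + 0))) = 0 ->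
  -1 * w0 * w0 + (1 * w1 * w1 + (1 * w2 * w2 + (1 * w3 * w3 + 0))) = 1 ->
  0 < C * p0 + S * w0.
Proof.
move=> CS C0 p00 pp pw ww.
have lagrange : (p1 ^+ 2 + p2 ^+ 2 + p3 ^+ 2) * (w1 ^+ 2 + w2 ^+ 2 + w3 ^+ 2) -
    (p1 * w1 + p2 * w2 + p3 * w3) ^+ 2 = (p1 * w2 - p2 * w1) ^+ 2 +
    (p1 * w3 - p3 * w1) ^+ 2 + (p2 * w3 - p3 * w2) ^+ 2 by ring.
have pE : p1 ^+ 2 + p2 ^+ 2 + p3 ^+ 2 = p0 ^+ 2 - 1 by lra.
have wE : w1 ^+ 2 + w2 ^+ 2 + w3 ^+ 2 = w0 ^+ 2 + 1 by lra.
have pwE : p1 * w1 + p2 * w2 + p3 * w3 = p0 * w0 by lra.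
rewrite pE wE pwE in lagrange.
(* The Lagrange expression equals p0^2 - w0^2 - 1, so its nonnegativity gives a strict
   inequality. *)
have wp : w0 ^+ 2 < p0 ^+ 2.
  suff : 0 <= (p0 ^+ 2 - 1) * (w0 ^+ 2 + 1) - (p0 * w0) ^+ 2 by lra.
  by rewrite lagrange !addr_ge0// sqr_ge0.
(* Otherwise 0 < C p0 <= - S w0, and squaring gives C^2 p0^2 <= (C^2 - 1) w0^2 <= C^2 w0^2, against
   w0^2 < p0^2. *)
rewrite ltNge; apply/negP => neg.
have Cp : 0 < C * p0 by rewrite mulr_gt0.
have : (C * p0) ^+ 2 <= (S * w0) ^+ 2.
  by rewrite -[leRHS]sqrrN ler_sqr ?nnegrE; lra.
have S2 : S ^+ 2 = C ^+ 2 - 1 by lra.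
rewrite !exprMn S2 leNgt => /negP; apply.
have C2 : 0 < C ^+ 2 by rewrite exprn_gt0.
have := sqr_ge0 w0; nra.
Qed.

(** * Explicit geodesics and the exponential map *)

Section Geodesics.
Context {R : realType} {M : space_form}.
Local Notation K := (curvature R M).
Local Notation vec := 'rV[R]_(ambient M).
Implicit Types (p v w : vec) (c : R -> vec) (r t : R).

(** Treats the sphere and the hyperboloid as one case. *)
Lemma curvature_cases : K = 0 \/ K * K = 1 /\ forall p, points p -> form p p = K.
Proof.
case: M => /=; [by left|right|right]; split; rewrite ?mulr1 ?mulrNN ?mulr1//.
by move=> p [].
Qed.

Lemma form_derive0 c t (dc : vec) a : (forall s, form (c s) (c s) = a) ->
  is_derive t (1 : R) c dc -> form (c t) dc = 0.
Proof.
move=> ca hc; have [_] := is_derive_form hc hc.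
rewrite (_ : (fun _ => _) = cst a) ?derive_cst; last exact/funext.
by rewrite (formC dc) => h; lra.
Qed.

(* For K <> 0, differentiating <c, c> = K twice gives <c'', c> = - <c', c'>, and
   the speed is constant because c'' is a multiple of c. *)
Lemma geodesic_ode c r : geodesic c -> form (derive1 c 0) (derive1 c 0) = r ^+ 2 ->
  forall t, is_derive t (1 : R) (derive1 c) (- (K * r ^+ 2) *: c t).
Proof.
move=> gc cr.
have dc t : is_derive t (1 : R) c (derive1 c t).
  by have [_ h _ _] := gc t; split; rewrite ?derive1E.
have ddc t : is_derive t (1 : R) (derive1 c) (derive1 (derive1 c) t).
  by have [_ _ h _] := gc t; split; rewrite ?derive1E.
have cov t : derive1 (derive1 c) t = (K * form (derive1 (derive1 c) t) (c t)) *: c t.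
  by have [_ _ _ /eqP] := gc t; rewrite subr_eq0 => /eqP.
move=> t; suff <- : derive1 (derive1 c) t = - (K * r ^+ 2) *: c t by [].
rewrite cov; case: curvature_cases => [K0|[KK pK]]; first by rewrite K0 !mul0r oppr0.
have cK s : form (c s) (c s) = K by apply: pK; have [] := gc s.
have cc' s : form (c s) (derive1 c s) = 0 := form_derive0 cK (dc s).
have c'c' s : form (derive1 c s) (derive1 c s) + form (c s) (derive1 (derive1 c) s) = 0.
  have [_ <-] := is_derive_form (dc s) (ddc s).
  rewrite (_ : (fun _ => _) = cst 0) ?derive_cst//; exact/funext.
have energy : form (derive1 c t) (derive1 c t) = r ^+ 2.
  rewrite -cr.
  apply: (is_derive_0_is_cst (f := fun s => form (derive1 c s) (derive1 c s))) => s.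
  apply: is_derive_eq (is_derive_form (ddc s) (ddc s)) _.
  by rewrite [form (derive1 c s) _]formC cov formZl cc' mulr0 addr0.
have := c'c' t; rewrite energy => /eqP; rewrite addrC addr_eq0 => /eqP h.
by rewrite formC h mulrN.
Qed.

(** [riem_exp] picks some geodesic with the given initial data; this formula shows that its endpoint
    does not depend on the choice. *)
Lemma geodesic_unique c r : 0 < r -> geodesic c ->
    form (derive1 c 0) (derive1 c 0) = r ^+ 2 ->
  forall t, c t = cs M (r * t) *: c 0 + (sn M (r * t) / r) *: derive1 c 0.
Proof.
move=> r0 gc cr t.
have dc s : is_derive s (1 : R) c (derive1 c s).
  by have [_ h _ _] := gc s; split; rewrite ?derive1E.
have ddc := geodesic_ode gc cr.
have dcs s := is_derive_csM M r s; have dsn s := is_derive_snM M r s.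
have dsnr k s : is_derive s (1 : R) (fun t => k * sn M (r * t)) (k * (r * cs M (r * s))).
  exact: is_deriveZ.
(* A and B invert the flow of c'' = - K r^2 c, hence are constant. *)
pose A s := cs M (r * s) *: c s + (- r^-1 * sn M (r * s)) *: derive1 c s.
pose B s := (K * r * sn M (r * s)) *: c s + cs M (r * s) *: derive1 c s.
have AE : A t = A 0.
  apply: eq_of_derive0_mx => s; apply: is_derive_eq.
    by apply: is_deriveD; apply: is_derive_scale.
  apply/rowP => i; rewrite !mxE; field; lra.
have BE : B t = B 0.
  apply: eq_of_derive0_mx => s; apply: is_derive_eq.
    by apply: is_deriveD; apply: is_derive_scale.
  apply/rowP => i; rewrite !mxE; ring.
have {}AE : c 0 = A t by rewrite AE /A mulr0 cs0 sn0 mulr0 scale1r scale0r addr0.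
have {}BE : derive1 c 0 = B t by rewrite BE /B mulr0 cs0 sn0 mulr0 scale1r scale0r add0r.
rewrite AE BE /A /B; apply/rowP => i; rewrite !mxE.
have h := cs2sn2 M (r * t).
(* Writing the factor 1 as cs^2 + K sn^2 turns the goal into a formal identity. *)
rewrite -[LHS]mul1r -h; field; lra.
Qed.

Lemma points_geodesic p w t : points p -> tangent p w -> form w w = 1 ->
  points (cs M t *: p + sn M t *: w).
Proof.
move=> pp pw ww; have := cs2sn2 M t.
have norm a b : form (a *: p + b *: w) (a *: p + b *: w) =
    a ^+ 2 * form p p + 2 * a * b * form p w + b ^+ 2 * form w w.
  by rewrite !(formDl, formDr, formZl, formZr) (formC w p); ring.
move: norm; case: M p w pp pw ww => // p w /= pp pw ww norm h.
  by rewrite norm pp pw ww; lra.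
case: pp => pp p0; split.
  by rewrite norm pp pw ww; lra.
have C0 : 0 < (expR t + expR (- t)) / 2 by rewrite divr_gt0// addr_gt0// expR_gt0.
rewrite !mxE; move: h C0; move: (_ / 2) (_ / 2) => S C h C0.
move: pp pw ww p0; rewrite /form /= !big_ord_recl !big_ord0 /=.
move=> pp pw ww p0; apply: hyperbolic_stay h C0 p0 _ _ _; rewrite ?mulrA;
  [exact: pp|exact: pw|exact: ww].
Qed.

Lemma is_derive_lincomb (a b : R -> R) t p w da db :
  is_derive t (1 : R) a da -> is_derive t (1 : R) b db ->
  is_derive t (1 : R) (fun s => a s *: p + b s *: w) (da *: p + db *: w).
Proof.
move=> ha hb; have hp := is_derive_cst p t (1 : R); have hw := is_derive_cst w t (1 : R).
apply: is_derive_eq; first by apply: is_deriveD; apply: is_derive_scale; eassumption.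
by rewrite !scaler0 !addr0.
Qed.

(** The explicit curve is a geodesic, so the set of endpoints is inhabited, and uniqueness
    identifies whichever element is chosen. *)
Lemma riem_expE p w r : 0 < r -> points p -> tangent p w -> form w w = 1 ->
  riem_exp p (r *: w) = cs M r *: p + sn M r *: w.
Proof.
move=> r0 pp pw ww.
pose c t := cs M (r * t) *: p + sn M (r * t) *: w.
pose c' t := (- K * r * sn M (r * t)) *: p + (r * cs M (r * t)) *: w.
have dc t : is_derive t (1 : R) c (c' t).
  by apply: is_derive_lincomb; [exact: is_derive_csM|exact: is_derive_snM].
have c'E : derive1 c = c'.
  by apply/funext => t; rewrite derive1E; have [] := dc t.
have dc' t : is_derive t (1 : R) c' (- (K * r ^+ 2) *: c t).
  apply: is_derive_eq.
    by apply: is_derive_lincomb; apply: is_deriveZ;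
      [exact: is_derive_snM|exact: is_derive_csM].
  by apply/rowP => i; rewrite !mxE /GRing.scale/=; ring.
have c_in t : points (c t) by exact: points_geodesic.
have c'0 : c' 0 = r *: w by rewrite /c' mulr0 cs0 sn0 !mulr0 scale0r add0r mulr1.
have c0 : c 0 = p by rewrite /c mulr0 cs0 sn0 scale1r scale0r addr0.
have gc : geodesic c.
  move=> t; split; [exact: c_in|by []|by rewrite c'E|].
  rewrite c'E /covariant_derivative derive1E; have [_ ->] := dc' t.
  rewrite /tangent_proj formZl; case: curvature_cases => [->|[KK /(_ _ (c_in t)) ->]].
    by rewrite !mul0r oppr0 !scale0r subr0.
  (* Since c'' = - K r^2 c and <c, c> = K, the tangential part of c'' is (K^2 - 1) K r^2 c. *)
  rewrite -scalerBl (_ : _ - _ = (K * K - 1) * K * r ^+ 2); last by ring.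
  by rewrite KK subrr !mul0r scale0r.
have norm v : v = r *: w -> form v v = r ^+ 2.
  by move=> ->; rewrite formZl formZr ww mulr1 expr2.
rewrite /riem_exp; set P := [set y | _].
(* The curve [c] is a witness, so [xget] does not fall back on the default [p]. *)
have [d [gd d0 d'0 d1]] : P (xget p P).
  by apply: xgetPex; exists (c 1), c; split => //; rewrite c'E.
rewrite -d1 (geodesic_unique r0 gd) ?mulr1 ?d0 ?d'0 ?norm//.
by rewrite scalerA divfK ?gt_eqF.
Qed.

End Geodesics.

(** * The tube and its metric *)

Lemma sum_ord2 (V : nmodType) (F : 'I_2 -> V) : \sum_i F i = F 0 + F 1.
Proof. by rewrite big_ord_recl big_ord1; congr (F _ + F _); exact: val_inj. Qed.

(** The stretching of T on the tube, with [a] the curvature of the core curve; its zeros are focal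
    points. It uses only the sums and products of [elementary]. *)
Definition tube_factor (R : realType) (C S a psi : R) : R := C + - (S * a) * cos psi.

Section Tube.
Context {R : realType} {M : space_form} {I : set R}
  {gamma T N B : R -> 'rV[R]_(ambient M)} {k1 k2 : R -> R}.
Hypothesis I_open : open I.
Hypothesis gamma_in_M : forall s, I s -> points (gamma s).
Hypothesis gamma_smooth : smooth_curve_on I gamma.
Hypothesis frame : frenet_frame I gamma T N B k1 k2.
Local Notation vec := 'rV[R]_(ambient M).
Local Notation stretch a rho := (tube_factor (cs M rho) (sn M rho) a).

Lemma gamma_derive s : I s -> is_derive s (1 : R) gamma (T s).
Proof.
move=> Is; split; first exact (@gamma_smooth 0%N s Is).
by rewrite (frenet_velocity frame Is) derive1E.
Qed.

(* The ambient normal component of V' is a multiple of <V', gamma> = - <V, T>. *)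
Lemma normal_derive (V : R -> vec) s : I s -> derivable V s 1 ->
  (forall t, I t -> tangent (gamma t) (V t)) -> form (T s) (V s) = 0 ->
  is_derive s (1 : R) V (covariant_derivative gamma V s).
Proof.
move=> Is dV VT TV; split=> //; rewrite /covariant_derivative /tangent_proj derive1E.
suff -> : curvature R M * form ('D_1 V s) (gamma s) = 0 by rewrite scale0r subr0.
have h := is_derive_form (gamma_derive Is) (derivableP dV).
have [_ /esym] := is_deriveZ (curvature R M) h.
rewrite TV add0r formC => E; apply: (etrans E).
(* K <gamma, V> vanishes on a whole neighbourhood of [s], as [I] is open. *)
rewrite (@near_eq_derive _ _ _ _ (cst 0)) ?derive_cst//.
by apply: filterS (I_open Is) => t It; exact: tangent_form (VT _ It).
Qed.

Lemma N_derive s : I s -> is_derive s (1 : R) N (- k1 s *: T s + k2 s *: B s).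
Proof.
move=> Is; rewrite -(frenet_DN frame Is); apply: normal_derive => //.
- exact (@frenet_smoothN _ _ _ _ _ _ _ _ _ frame 0%N s Is).
- by move=> t /(frenet_tangent frame)[].
- by have [] := frenet_orthogonal frame Is.
Qed.

Lemma B_derive s : I s -> is_derive s (1 : R) B (- k2 s *: N s).
Proof.
move=> Is; rewrite -(frenet_DB frame Is); apply: normal_derive => //.
- exact (@frenet_smoothB _ _ _ _ _ _ _ _ _ frame 0%N s Is).
- by move=> t /(frenet_tangent frame)[].
- by have [] := frenet_orthogonal frame Is.
Qed.

Definition angular (s psi : R) : vec := - sin psi *: N s + cos psi *: B s.

Lemma tubeE rho (q : 'rV[R]_2) : 0 < rho -> tube_domain I q ->
  tube gamma N B rho q = cs M rho *: gamma (q 0 0) +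
    sn M rho *: (cos (q 0 1) *: N (q 0 0) + sin (q 0 1) *: B (q 0 0)).
Proof.
move=> rho0 Is; rewrite /tube -!scalerA -scalerDr.
have [_ tN tB] := frenet_tangent frame Is.
have [_ nN nB] := frenet_unit frame Is; have [_ _ nNB] := frenet_orthogonal frame Is.
apply: riem_expE => //; [exact: gamma_in_M|exact: tangent_lin|].
rewrite !(formDl, formDr, formZl, formZr) (formC (B _)) nN nB nNB.
by rewrite -[RHS](cos2Dsin2 (q 0 1)); ring.
Qed.

Lemma tube_domain_open : open (tube_domain I).
Proof.
apply: (open_comp (f := fun q : 'rV[R]_2 => q 0 0)) => // q _.
exact: coord_continuous.
Qed.

(** Differentiate the closed form of the tube, valid near [q], by the Frenet equations: the k1 term
    joins the T component and the k2 terms combine into [angular]. An arbitrary direction [v] serves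
    both the metric and the rank condition. *)
Lemma tube_derive rho (q v : 'rV[R]_2) : 0 < rho -> tube_domain I q ->
  is_derive q v (tube gamma N B rho)
    ((v 0 0 * stretch (k1 (q 0 0)) rho (q 0 1)) *: T (q 0 0) +
     (sn M rho * (k2 (q 0 0) * v 0 0 + v 0 1)) *: angular (q 0 0) (q 0 1)).
Proof.
move=> rho0 Is.
pose X (q : 'rV[R]_2) := cs M rho *: gamma (q 0 0) +
    sn M rho *: (cos (q 0 1) *: N (q 0 0) + sin (q 0 1) *: B (q 0 0)).
apply: (@near_eq_is_derive _ _ _ X).
  by apply: filterS (tube_domain_open Is) => q' Is'; rewrite tubeE.
have hg := is_derive_comp_proj v (gamma_derive Is).
have hN := is_derive_comp_proj v (N_derive Is).
have hB := is_derive_comp_proj v (B_derive Is).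
have hc := is_derive_comp_proj v (is_derive_cos (q 0 1)).
have hs := is_derive_comp_proj v (is_derive_sin (q 0 1)).
have hcN := is_derive_scale hc hN.
have hsB := is_derive_scale hs hB.
apply: is_derive_eq.
apply/rowP => i; rewrite !mxE /tube_factor /GRing.scale/=; ring.
Qed.

(** T and [angular] are orthonormal. *)
Lemma tube_derive_form rho (q v w : 'rV[R]_2) : 0 < rho -> tube_domain I q ->
  form ('D_v (tube gamma N B rho) q) ('D_w (tube gamma N B rho) q) =
  v 0 0 * w 0 0 * stretch (k1 (q 0 0)) rho (q 0 1) ^+ 2 +
  sn M rho ^+ 2 * (k2 (q 0 0) * v 0 0 + v 0 1) * (k2 (q 0 0) * w 0 0 + w 0 1).
Proof.
move=> rho0 Is; have [_ ->] := tube_derive v rho0 Is; have [_ ->] := tube_derive w rho0 Is.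
have [nT nN nB] := frenet_unit frame Is; have [nTN nTB nNB] := frenet_orthogonal frame Is.
have aT : form (T (q 0 0)) (angular (q 0 0) (q 0 1)) = 0.
  by rewrite /angular formDr !formZr nTN nTB !mulr0 addr0.
have aa : form (angular (q 0 0) (q 0 1)) (angular (q 0 0) (q 0 1)) = 1.
  rewrite /angular !(formDl, formDr, formZl, formZr) (formC (B _)) nN nB nNB.
  by rewrite -[RHS](cos2Dsin2 (q 0 1)); ring.
move: (tube_factor _ _ _ _) => f; move: (angular _ _) aT aa => n aT aa.
rewrite !(formDl, formDr, formZl, formZr) (formC n) aT aa nT; ring.
Qed.

(** If either quantity vanished, the differential of the tube would kill a nonzero vector: (0, 1)
    when [sn M rho] is 0, and (1, - k2) when the stretching factor is 0. *)
Lemma tube_nondegenerate rho (q : 'rV[R]_2) : 0 < rho -> tube_domain I q ->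
  row_free (\matrix_(i < 2) partial i (tube gamma N B rho) q) ->
  sn M rho != 0 /\ stretch (k1 (q 0 0)) rho (q 0 1) != 0.
Proof.
move=> rho0 Is free.
have inj (u : 'rV[R]_2) : 'D_u (tube gamma N B rho) q = 0 -> u = 0.
  move=> u0; apply: (row_free_inj free); rewrite mul0mx -{}u0 mulmx_sum_row.
  have [_ ->] := tube_derive u rho0 Is.
  rewrite sum_ord2 2!rowK /partial.
  have [_ ->] := tube_derive (delta_mx 0 0) rho0 Is.
  have [_ ->] := tube_derive (delta_mx 0 1) rho0 Is.
  by apply/rowP => i; rewrite !mxE /=; ring.
split; apply/eqP => z0.
  have /rowP/(_ 1) : (\row_i (i == 1)%:R : 'rV[R]_2) = 0.
    apply: inj; have [_ ->] := tube_derive (\row_i (i == 1)%:R) rho0 Is.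
    by rewrite !mxE /= z0 !mul0r !scale0r addr0.
  by rewrite !mxE /= => /eqP; rewrite oner_eq0.
have /rowP/(_ 0) : (\row_i (if i == 0 then 1 else - k2 (q 0 0)) : 'rV[R]_2) = 0.
  apply: inj.
  have [_ ->] := tube_derive (\row_i (if i == 0 then 1 else - k2 (q 0 0))) rho0 Is.
  by rewrite !mxE /= z0 mulr0 mulr1 subrr mulr0 !scale0r addr0.
by rewrite !mxE /= => /eqP; rewrite oner_eq0.
Qed.

End Tube.

Lemma invmx_right_inverse (R : comUnitRingType) n (A B : 'M[R]_n) :
  A *m B = 1%:M -> invmx A = B.
Proof. by move=> AB; have [uA _] := mulmx1_unit AB; rewrite -(mulKmx uA B) AB mulmx1. Qed.

(** * The Hamiltonian of the tube *)

Section ClairautHamiltonian.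
Context {R : realType} (C S a b : R).
Local Notation phase := 'rV[R]_(2 + 2).
Local Notation "'psi_'" := (lshift 2 (1 : 'I_2)).
Local Notation "'ps_'" := (rshift 2 (0 : 'I_2)).
Local Notation "'pp_'" := (rshift 2 (1 : 'I_2)).
Implicit Types z : phase.

(** Here [a] and [b] stand for k1 and k2. Squares are spelled as products and the difference as a
    sum, so that the constructors of [elementary] apply. *)
Definition tube_hamiltonian z : R :=
  2^-1 * ((z 0 ps_ + (- b) * z 0 pp_) * (z 0 ps_ + (- b) * z 0 pp_)
            * ((tube_factor C S a (z 0 psi_))^-1 * (tube_factor C S a (z 0 psi_))^-1)
          + S^-1 * S^-1 * (z 0 pp_ * z 0 pp_)).

Definition momentum z : R := z 0 ps_.

Lemma tube_hamiltonian_elementary (W : set phase) :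
  (forall z, W z -> tube_factor C S a (z 0 psi_) != 0) -> elementary W tube_hamiltonian.
Proof.
move=> W0; rewrite /tube_hamiltonian /tube_factor.
have ef : elementary W (fun z => (C + - (S * a) * cos (z 0 psi_))^-1).
  apply: elementaryV => //; do ?[exact: elementary_cst|exact: elementary_coord
    |apply: elementaryD|apply: elementaryM|apply: elementary_cos].
by do ?[exact: ef|exact: elementary_cst|exact: elementary_coord
    |apply: elementaryD|apply: elementaryM].
Qed.

Lemma tube_hamiltonian_slope z :
  partial pp_ tube_hamiltonian z =
  - b * (z 0 ps_ - b * z 0 pp_) * (tube_factor C S a (z 0 psi_)) ^- 2 + z 0 pp_ * S ^- 2.
Proof.
rewrite /partial; set d := RHS.
suff [] : is_derive z (delta_mx 0 pp_) tube_hamiltonian d by [].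
apply: is_derive_line; set f := (tube_factor C S a (z 0 psi_))^-1.
(* On a line parallel to the p_psi axis the Hamiltonian is a quadratic polynomial in [t], whose
   linear coefficient is [d]; here [f] is the inverse of the stretching factor. *)
rewrite (_ : (fun _ => _) = (2^-1 * (b ^+ 2 * f ^+ 2 + S ^- 2)) \*: (id * id) + d \*: id +
   cst (tube_hamiltonian z)); last first.
  apply/funext => t; rewrite /tube_hamiltonian /d !mxE /= !mulr0 !add0r.
  rewrite fctE /= fctE /= -!exprVn /GRing.scale/= -/f -[(id * id) t]/(t * t).
  by move: S^-1 => r; field.
apply: is_derive_eq.
by rewrite !scale0r !add0r scaler0 add0r addr0 [LHS]mulr1.
Qed.

Lemma tube_hamiltonian_cyclic z : partial (lshift 2 (0 : 'I_2)) tube_hamiltonian z = 0.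
Proof.
suff [] : is_derive z (delta_mx 0 (lshift 2 (0 : 'I_2))) tube_hamiltonian 0 by [].
apply: is_derive_line; rewrite (_ : (fun _ => _) = cst (tube_hamiltonian z)).
  exact: is_derive_cst.
by apply/funext => t; rewrite /tube_hamiltonian !mxE /= !mulr0 !add0r.
Qed.

Lemma partial_momentum j z : partial j momentum z = (j == ps_)%:R.
Proof.
have [_ h] := is_derive_proj ps_ z (delta_mx 0 j).
by rewrite /partial h mxE eqxx eq_sym.
Qed.

Lemma tube_hamiltonian_geodesic (g : 'rV[R]_2 -> 'M[R]_2) z :
  S != 0 -> tube_factor C S a (z 0 psi_) != 0 ->
  (forall i j : 'I_2, g (lsubmx z) i j =
     (i == 0)%:R * (j == 0)%:R * tube_factor C S a (z 0 psi_) ^+ 2 +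
     S ^+ 2 * (b * (i == 0)%:R + (i == 1)%:R) * (b * (j == 0)%:R + (j == 1)%:R)) ->
  geodesic_hamiltonian g z = tube_hamiltonian z.
Proof.
move=> S0 f0 gE; rewrite /tube_hamiltonian; set f := tube_factor _ _ _ _ in f0 gE *.
have -> : geodesic_hamiltonian g z = 2^-1 *
    \sum_(i < 2) \sum_(j < 2)
      invmx (g (lsubmx z)) i j * z 0 (rshift 2 i) * z 0 (rshift 2 j).
  by congr (_ * _); apply: eq_bigr => i _; apply: eq_bigr => j _; rewrite !mxE.
(* The metric is f^2 times the square of the covector (1, 0) plus S^2 times that of (b, 1). The dual
   basis is (1, - b), (0, 1), which gives the inverse matrix. *)
rewrite (@invmx_right_inverse _ _ _ (\matrix_(i, j) ((f ^- 2) *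
    ((i == 0)%:R - b * (i == 1)%:R) * ((j == 0)%:R - b * (j == 1)%:R) +
    (i == 1)%:R * (j == 1)%:R * S ^- 2))).
  by rewrite !sum_ord2 !mxE /=; field; rewrite f0 S0.
apply/matrixP => i j; rewrite !mxE sum_ord2 !mxE !gE.
have [->|->] : i = 0 \/ i = 1 by case: i => -[|[|//]] ?; [left|right]; exact: val_inj.
all: have [->|->] : j = 0 \/ j = 1 by case: j => -[|[|//]] ?; [left|right]; exact: val_inj.
all: rewrite /=; field; rewrite ?f0 ?S0//.
Qed.

End ClairautHamiltonian.

(** * Open sets and closures in phase space *)

Lemma cotangent_open (R : realType) (I : set R) :
  open I -> open (cotangent (tube_domain I)).
Proof.
move=> oI; rewrite (_ : cotangent _ = (fun z : 'rV[R]_(2 + 2) => z 0 (lshift 2 0)) @^-1` I).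
  by apply: open_comp => // q _; exact: coord_continuous.
by apply/seteqP; split=> z /=; rewrite /cotangent/tube_domain/= mxE.
Qed.

Lemma near_line (R : realType) (V : normedModType R) (A : set V) (z v : V) :
  nbhs z A -> \forall t \near (0 : R), A (t *: v + z).
Proof.
move=> zA; have : t *: v + z @[t --> (0 : R)] --> z.
  rewrite -[X in _ --> X]add0r -[X in X + z](scale0r v).
  by apply: cvgD; [apply: cvgZr_tmp; exact: cvg_id|exact: cvg_cst].
by apply.
Qed.

(** The neighbourhood is punctured because in the application [z] itself may lie outside [A]. *)
Lemma closure_line (R : realType) (V : normedModType R) (A : set V) (z v : V) :
  (\forall t \near (0 : R)^', A (t *: v + z)) -> closure A z.
Proof.
move=> nA B /(near_line v) nB; near (0 : R)^' => t; exists (t *: v + z); split.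
  by near: t.
near: t; exact: nbhs_dnbhs.
Unshelve. all: by end_near. Qed.

(** * Involution and independence of the energy and the Clairaut integral *)

Section Integrability.
Context {R : realType} (C S a b : R).
Local Notation phase := 'rV[R]_(2 + 2).
Local Notation h := (tube_hamiltonian C S a b).
Variable W : set phase.
Hypothesis W_open : open W.
Hypothesis S_neq0 : S != 0.
Hypothesis factor_neq0 : forall z, W z ->
  tube_factor C S a (z 0 (lshift 2 (1 : 'I_2))) != 0.

Definition tube_integrals (i : 'I_2) : phase -> R :=
  if i == 0 then h else @momentum R.

Lemma poisson_momentum z : poisson (@momentum R) h z = 0.
Proof.
rewrite /poisson sum_ord2 /dq /dp !partial_momentum tube_hamiltonian_cyclic /=.
by rewrite !mul0r mulr0 !subr0 addr0.
Qed.

Lemma tube_integralsP i : tube_integrals i = h \/ tube_integrals i = @momentum R.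
Proof. by rewrite /tube_integrals; case: eqP; [left|right]. Qed.

Lemma poisson_tube_integrals i j z : poisson (tube_integrals i) (tube_integrals j) z = 0.
Proof.
have [->|->] := tube_integralsP i; have [->|->] := tube_integralsP j.
- exact: poisson_self.
- by rewrite poisson_anti poisson_momentum oppr0.
- exact: poisson_momentum.
- exact: poisson_self.
Qed.

Lemma tube_integrals_elementary i : elementary W (tube_integrals i).
Proof.
have [->|->] := tube_integralsP i; first exact: tube_hamiltonian_elementary.
exact: elementary_coord.
Qed.

Lemma tube_integrals_first_integral i : first_integral W h (tube_integrals i).
Proof.
apply: first_integral_poisson => z Wz.
  exact: elementary_differentiable (tube_integrals_elementary i) _ Wz.
(* The integral of index 0 is the Hamiltonian, so involution already contains conservation. *)
exact: (poisson_tube_integrals i 0).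
Qed.

Lemma tube_integrals_periodic i z :
  tube_integrals i (z + row_mx (tube_period R) 0) = tube_integrals i z.
Proof.
have Ep k : (z + row_mx (tube_period R) 0) 0 (rshift 2 k) = z 0 (rshift 2 k).
  by rewrite mxE row_mxEr mxE addr0.
have Eq : (z + row_mx (tube_period R) 0) 0 (lshift 2 (1 : 'I_2)) =
    z 0 (lshift 2 (1 : 'I_2)) + pi *+ 2.
  by rewrite mxE row_mxEl !mxE /= mulr1 mulr_natl.
rewrite /tube_integrals /tube_hamiltonian /momentum /tube_factor.
by case: ifP => _; rewrite !Ep // Eq cosD2pi.
Qed.

(** The differential of [momentum] has p_s as its only nonzero entry, so the p_s and p_psi columns
    of the Jacobian form a triangular block, invertible under the hypothesis. *)
Lemma tube_integrals_independent z :
  partial (rshift 2 (1 : 'I_2)) h z != 0 -> independent_at tube_integrals z.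
Proof.
move=> h0; rewrite /independent_at -kermx_eq0; apply/rowV0P => u /sub_kermxP uA.
have E k : u 0 0 * partial k h z + u 0 1 * (k == rshift 2 (0 : 'I_2))%:R = 0.
  have /rowP/(_ k) := uA; rewrite !mxE sum_ord2 !mxE /tube_integrals /=.
  by rewrite partial_momentum.
have u0 : u 0 0 = 0.
  have /eqP := E (rshift 2 1); rewrite /= mulr0 addr0 mulf_eq0 (negPf h0) orbF.
  by move/eqP.
have u1 : u 0 1 = 0.
  by have := E (rshift 2 0); rewrite u0 mul0r add0r eqxx mulr1.
apply/rowP => i; rewrite mxE.
by have [->|->] : i = 0 \/ i = 1 by case: i => -[|[|//]] ?; [left|right]; exact: val_inj.
Qed.

Lemma tube_integrals_dense :
  W `<=` closure (W `&` [set z | independent_at tube_integrals z]).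
Proof.
move=> z Wz; pose e : phase := delta_mx 0 (rshift 2 (1 : 'I_2)).
(* The second derivative of the Hamiltonian in p_psi, positive thanks to [S ^- 2]. The slope is
   affine along the line with rate [c]; if it vanishes at [z], it is nonzero at all other points of
   the line. *)
pose c := b ^+ 2 * (tube_factor C S a (z 0 (lshift 2 1))) ^- 2 + S ^- 2.
have c0 : 0 < c.
  rewrite ltr_wpDl// ?invr_gt0 ?exprn_even_gt0//.
  by rewrite mulr_ge0// ?invr_ge0 sqr_ge0.
have slope t : partial (rshift 2 1) h (t *: e + z) = partial (rshift 2 1) h z + t * c.
  by rewrite !tube_hamiltonian_slope !mxE /= !mulr0 !add0r /c; ring.
have nW : \forall t \near (0 : R), W (t *: e + z) := near_line e (W_open Wz).
have [h0|h0] := eqVneq (partial (rshift 2 1) h z) 0; last first.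
  by apply: subset_closure; split=> //; exact: tube_integrals_independent.
apply: (@closure_line _ _ _ _ e); near=> t; split.
  by near: t; exact: nbhs_dnbhs.
apply: tube_integrals_independent; rewrite slope h0 add0r mulf_neq0 ?(gt_eqF c0)//.
by near: t; exact: nbhs_dnbhs_neq.
Unshelve. all: by end_near. Qed.

End Integrability.

Theorem theorem2p1 (R : realType) (M : space_form) (I : set R)
    (gamma T N B : R -> 'rV[R]_(ambient M)) (k1 k2 : R -> R) (rho0 : R)
    (I_nonempty : I !=set0) (I_open : open I) (I_interval : is_interval I)
    (gamma_in_M : forall s, I s -> points (gamma s))
    (gamma_smooth : smooth_curve_on I gamma)
    (gamma_simple : forall s t, I s -> I t -> gamma s = gamma t -> s = t)
    (gamma_frenet : frenet_frame I gamma T N B k1 k2)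
    (k1_constant : constant_on I k1) (k2_constant : constant_on I k2)
    (rho0_gt0 : 0 < rho0)
    (tube_ok : well_defined_tube I gamma N B rho0) :
  geodesic_flow_liouville_integrable (tube_domain I) (tube_period R)
    (induced_metric (tube gamma N B rho0)).
Proof.
have [s0 Is0] := I_nonempty.
(* The values at [s0] serve as the constants k1 and k2; the immersion condition is used at radius
   [rho0] itself. *)
have nondeg q : tube_domain I q ->
    sn M rho0 != 0 /\ tube_factor (cs M rho0) (sn M rho0) (k1 s0) (q 0 1) != 0.
  move=> Iq; rewrite (k1_constant s0 _ Is0 Iq).
  apply: (tube_nondegenerate I_open gamma_in_M gamma_smooth gamma_frenet) => //.
  by apply: (tube_ok.1 rho0) => //; rewrite rho0_gt0 lexx.
have Iq0 : tube_domain I (const_mx s0) by rewrite /tube_domain/= mxE.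
have [S0 _] := nondeg _ Iq0.
pose W := cotangent (tube_domain I).
have W_open : open W by exact: cotangent_open.
have f0 (z : 'rV[R]_(2 + 2)) : W z ->
    tube_factor (cs M rho0) (sn M rho0) (k1 s0) (z 0 (lshift 2 (1 : 'I_2))) != 0.
  by move=> /nondeg[_]; rewrite mxE.
(* The two Hamiltonians are compared on [W] only, where the tube has its closed form and the metric
   is invertible. *)
have HE z : W z -> tube_hamiltonian (cs M rho0) (sn M rho0) (k1 s0) (k2 s0) z =
    geodesic_hamiltonian (induced_metric (tube gamma N B rho0)) z.
  move=> Wz; apply/esym/tube_hamiltonian_geodesic => //; first exact: f0.
  move=> i j; rewrite !mxE.
  rewrite /partial (tube_derive_form I_open gamma_in_M gamma_smooth gamma_frenet)//.
  rewrite -(k1_constant s0 _ Is0 Wz) -(k2_constant s0 _ Is0 Wz) !mxE /=.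
  by rewrite ![0 == _]eq_sym ![1 == _]eq_sym.
exists (tube_integrals (cs M rho0) (sn M rho0) (k1 s0) (k2 s0)); split.
- move=> i; split; last by move=> z _; exact: tube_integrals_periodic.
  by apply: elementary_smooth => //; exact: tube_integrals_elementary.
- move=> i; apply: first_integral_ext W_open HE _.
  exact: tube_integrals_first_integral.
- by move=> i j z _; exact: poisson_tube_integrals.
- exact: tube_integrals_dense.
Qed.
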